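(* Let $R$ be a nonzero ring, and let $G\neq 1$ be a locally finite group in which each finite subgroup has odd order. Then the group ring $RG$ is not strongly $J^{\#}$-clean.
   Context: All rings are associative with identity, not necessarily commutative. $J(R)$ denotes the Jacobson radical of $R$ and $J^{\#}(R)=\{z\in R : z^n\in J(R)\text{ for some } n\ge 1\}$. A ring $R$ is strongly $J^{\#}$-clean if every $a\in R$ can be written $a=e+j$ with $e^2=e\in R$, $j\in J^{\#}(R)$ and $ej=je$. $RG$ is the usual group ring of $G$ over $R$. A group is locally finite if each of its finitely generated subgroups is finite. *)

(* Defs.v *)
From HB Require Import structures.
From mathcomp Require Import all_boot all_order all_algebra finmap.
From mathcomp Require Import all_classical.
From mathcomp.multinomials Require Import monalg.

Set Implicit Arguments.
Unset Strict Implicit.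
Unset Printing Implicit Defensive.

Import GRing.Theory.

Local Open Scope classical_set_scope.
Local Open Scope ring_scope.

Section RingNotions.
Variable S : nzRingType.

(* idealr_closed I says that I is an additive subgroup with 1 \notin I and
   a * u \in I for all a and all u \in I, that is, a proper left ideal. *)
Definition maximal_left_ideal (M : set S) : Prop :=
  idealr_closed [in M] /\
  forall I : set S, idealr_closed [in I] -> M `<=` I -> I = M.

Definition jacobson_radical : set S :=
  \bigcap_(M in maximal_left_ideal) M.

Definition jsharp : set S :=
  [set z | exists2 n, (0 < n)%N & jacobson_radical (z ^+ n)].

Definition strongly_jsharp_clean : Prop :=
  forall a : S, exists e j : S,
    [/\ a = e + j, e * e = e, jsharp j & e * j = j * e].

End RingNotions.

Section GroupNotions.
Variable G : groupType.

Definition is_subgroup (H : set G) : Prop := group_closed [in H].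

Definition generated_subgroup (A : set G) : set G := smallest is_subgroup A.

Definition locally_finite : Prop :=
  forall A : set G, finite_set A -> finite_set (generated_subgroup A).

End GroupNotions.

Arguments locally_finite : clear implicits.
Arguments strongly_jsharp_clean : clear implicits.

(* The library makes {malg R[K]} a ring only when K is a monomType, which
   excludes nontrivial groups since x * y = 1 must imply x = y = 1 there.
   We keep its additive group of finitely supported functions K -> R. *)
Definition group_ring (R : nzRingType) (G : groupType) : Type := {malg R[G]}.

HB.instance Definition _ (R : nzRingType) (G : groupType) :=
  GRing.Zmodule.copy (group_ring R G) {malg R[G]}.

Section GroupRing.
Variables (R : nzRingType) (G : groupType).
Implicit Types (f g h : {malg R[G]}) (x y : G).

Definition gr_one : {malg R[G]} := << 1 *g 1%g >>.

Definition gr_mul g h : {malg R[G]} :=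
  \sum_(x <- msupp g) \sum_(y <- msupp h) << g@_x * h@_y *g (x * y)%g >>.

Lemma gr_mulEw (d1 d2 : {fset G}) g h :
  (msupp g `<=` d1)%fset -> (msupp h `<=` d2)%fset ->
  gr_mul g h =
    \sum_(x <- d1) \sum_(y <- d2) << g@_x * h@_y *g (x * y)%g >>.
Proof.
move=> le1 le2; rewrite /gr_mul (big_fset_incl _ le1) /=; last first.
  move=> x _ /mcoeff_outdom gx.
  by rewrite big1 // => y _; rewrite gx mul0r monalgU0.
apply: eq_bigr => x _; apply: big_fset_incl => // y _ /mcoeff_outdom ->.
by rewrite mulr0 monalgU0.
Qed.

Lemma gr_mulUU (a b : R) x y :
  gr_mul << a *g x >> << b *g y >> = << a * b *g (x * y)%g >>.
Proof. by rewrite (gr_mulEw msuppU_le msuppU_le) !big_seq_fset1 !mcoeffUU. Qed.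

Lemma gr_mulDl : left_distributive gr_mul +%R.
Proof.
move=> f g h; have lehh := fsubset_refl (msupp h).
rewrite (gr_mulEw (fsubsetUl (msupp f) (msupp g)) lehh).
rewrite (gr_mulEw (fsubsetUr (msupp f) (msupp g)) lehh).
rewrite (gr_mulEw (msuppD_le _ _) lehh) -big_split /=; apply: eq_bigr => x _.
rewrite -big_split /=; apply: eq_bigr => y _.
by rewrite mcoeffD mulrDl monalgUD.
Qed.

Lemma gr_mulDr : right_distributive gr_mul +%R.
Proof.
move=> f g h; have leff := fsubset_refl (msupp f).
rewrite (gr_mulEw leff (fsubsetUl (msupp g) (msupp h))).
rewrite (gr_mulEw leff (fsubsetUr (msupp g) (msupp h))).
rewrite (gr_mulEw leff (msuppD_le _ _)) -big_split /=; apply: eq_bigr => x _.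
rewrite -big_split /=; apply: eq_bigr => y _.
by rewrite mcoeffD mulrDr monalgUD.
Qed.

Lemma gr_mul0l : left_zero 0 gr_mul.
Proof. by move=> g; rewrite /gr_mul msupp0 big_seq_fset0. Qed.

Lemma gr_mul0r : right_zero 0 gr_mul.
Proof.
by move=> g; rewrite /gr_mul big1 // => x _; rewrite msupp0 big_seq_fset0.
Qed.

Lemma gr_mul_suml (I : Type) (r : seq I) (F : I -> {malg R[G]}) h :
  gr_mul (\sum_(i <- r) F i) h = \sum_(i <- r) gr_mul (F i) h.
Proof.
exact: (big_morph (gr_mul^~ h) (fun f g => gr_mulDl f g h) (gr_mul0l h)).
Qed.

Lemma gr_mul_sumr (I : Type) (r : seq I) (F : I -> {malg R[G]}) h :
  gr_mul h (\sum_(i <- r) F i) = \sum_(i <- r) gr_mul h (F i).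
Proof.
exact: (big_morph (gr_mul h) (fun f g => gr_mulDr h f g) (gr_mul0r h)).
Qed.

Lemma gr_mul1l : left_id gr_one gr_mul.
Proof.
move=> g; rewrite [in LHS](monalgE g) gr_mul_sumr [RHS]monalgE.
by apply: eq_bigr => x _; rewrite gr_mulUU mul1r mul1g.
Qed.

Lemma gr_mul1r : right_id gr_one gr_mul.
Proof.
move=> g; rewrite [in LHS](monalgE g) gr_mul_suml [RHS]monalgE.
by apply: eq_bigr => x _; rewrite gr_mulUU mulr1 mulg1.
Qed.

Lemma gr_mulA : associative gr_mul.
Proof.
move=> f g h; rewrite (monalgE f) !gr_mul_suml; apply: eq_bigr => x _.
rewrite (monalgE g) gr_mul_sumr !gr_mul_suml gr_mul_sumr; apply: eq_bigr => y _.
rewrite (monalgE h) !gr_mul_sumr; apply: eq_bigr => z _.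
by rewrite !gr_mulUU mulrA mulgA.
Qed.

Lemma gr_one_neq0 : gr_one != 0.
Proof. by rewrite /gr_one monalgU_eq0 oner_eq0. Qed.

HB.instance Definition _ := GRing.Zmodule_isNzRing.Build (group_ring R G)
  gr_mulA gr_mul1l gr_mul1r gr_mulDl gr_mulDr gr_one_neq0.

End GroupRing.

(* Main.v *)
Require Import Defs.
From mathcomp Require Import all_boot all_order all_algebra finmap.
From mathcomp Require Import all_classical.
From mathcomp.multinomials Require Import monalg.

(** The contradiction comes from a single element [x <> 1]: local finiteness
    gives [x ^ n = 1] with [n] odd, and in a strongly J#-clean ring an element
    [g] with [g ^ n = 1], [n] odd, must be [1] ([clean_odd_torsion]). Apply
    this to the copy of [x] in the group ring.

    Modulo the Jacobson radical [J] a decomposition [a = e + j] has [j]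
    nilpotent and commuting with [e]. If [a] is a unit, then so is the
    idempotent [e = a - j], whence [e = 1] and [a - 1] is nilpotent modulo [J]
    ([clean_jsharp_subr1]). For [a = 2] one finds that [2] itself is nilpotent
    modulo [J] ([clean_jsharp2]). Hence for [g ^ n = 1] the element
    [s = 1 + g + ... + g ^ (n - 1)], which differs from [n] by a multiple of
    [g - 1], is the sum of a unit (as [n] is odd) and a commuting nilpotent
    modulo [J]. So [s] is left invertible, and [s * (g - 1) = g ^ n - 1 = 0]
    forces [g = 1].

    Everything rests on [J] being a left ideal. It is the intersection of the
    maximal left ideals, an element outside all of these has a left inverse
    ([left_inverse_ex], by Zorn's lemma), and [J] contains no nonzero
    idempotent ([jacobson_idempotent]). *)

Set Implicit Arguments.
Unset Strict Implicit.

Import GRing.Theory.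
Local Open Scope classical_set_scope.
Local Open Scope ring_scope.

(** * Maximal left ideals and the Jacobson radical *)

Section LeftIdeals.
Variable S : nzRingType.
Implicit Types (I M : set S) (a f s u v : S).

Lemma idealr_closedP I :
  idealr_closed [in I] <->
  [/\ I 0, ~ I 1 & forall a u v, I u -> I v -> I (a * u + v)].
Proof.
split=> [[I0 I1 Iau]|[I0 I1 Iau]].
  split; [exact: set_mem I0|by move/mem_set; apply/negP|].
  by move=> a u v Iu Iv; apply/set_mem/Iau; exact: mem_set.
split; [exact: mem_set|by apply/negP => /set_mem|].
by move=> a u v /set_mem Iu /set_mem Iv; exact/mem_set/Iau.
Qed.

Lemma idealr_mull {I} a u : idealr_closed [in I] -> I u -> I (a * u).
Proof.
by case/idealr_closedP=> I0 _ Iau Iu; rewrite -[_ * _]addr0; exact: Iau.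
Qed.

Lemma idealrD {I} u v : idealr_closed [in I] -> I u -> I v -> I (u + v).
Proof.
by case/idealr_closedP=> _ _ Iau Iu Iv; rewrite -[u]mul1r; exact: Iau.
Qed.

(** Zorn's lemma is applied to the sets whose union with [I] is a proper left
    ideal: this family is closed under unions of chains even for the empty
    chain, which fails for the proper left ideals containing [I]. *)
Lemma maximal_left_ideal_above I :
  idealr_closed [in I] -> exists2 M, maximal_left_ideal M & I `<=` M.
Proof.
move=> idI; pose P X := idealr_closed [in X `|` I].
have [F FP totF|A [PA maxA]] := @Zorn_bigcup S P.
  have [I0 I1 Iau] := iffLR (idealr_closedP I) idI.
  apply/idealr_closedP; split; first by right.
    case=> [[X FX X1]|]; last exact: I1.
    by have [_ + _] := iffLR (idealr_closedP _) (FP X FX); apply; left.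
  have closed X : F X ->
      forall a u v, (X `|` I) u -> (X `|` I) v ->
      (\bigcup_(Y in F) Y `|` I) (a * u + v).
    move=> FX a u v Xu Xv.
    have [_ _ Xau] := iffLR (idealr_closedP _) (FP X FX).
    by have [?|?] := Xau a u v Xu Xv; [left; exists X|right].
  move=> a u v [[X FX Xu]|Iu] [[Y FY Yv]|Iv].
  - have [XY|YX] := totF X Y FX FY.
      by apply: (closed Y) => //; left => //; exact: XY.
    by apply: (closed X) => //; left => //; exact: YX.
  - by apply: (closed X) => //; [left|right].
  - by apply: (closed Y) => //; [right|left].
  - by right; exact: Iau.
exists (A `|` I); last by right.
split=> // K idK AIK; apply/seteqP; split=> // x Kx.
apply: contrapT => AIx; apply: (maxA K).
  split=> [|KA]; first by move=> y Ay; apply: AIK; left.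
  by apply: AIx; left; exact: KA.
by rewrite /P setUidl // => y Iy; apply: AIK; right.
Qed.

(** Otherwise [s] generates a proper left ideal, which is contained in a
    maximal one. *)
Lemma left_inverse_ex s :
  (forall M, maximal_left_ideal M -> ~ M s) -> exists u, u * s = 1.
Proof.
move=> sM; apply: contrapT => noinv.
have idSs : idealr_closed [in range (fun a => a * s)].
  apply/idealr_closedP; split.
  - by exists 0 => //; rewrite mul0r.
  - by case=> u _ us1; apply: noinv; exists u.
  move=> a _ _ [b _ <-] [c _ <-]; exists (a * b + c) => //.
  by rewrite mulrDl mulrA.
have [M maxM sub] := maximal_left_ideal_above idSs.
by apply: (sM M maxM); apply: sub; exists 1 => //; rewrite mul1r.
Qed.

Lemma jacobson_mull a u :
  jacobson_radical u -> jacobson_radical (a * u).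
Proof. by move=> Ju M maxM; apply: idealr_mull maxM.1 (Ju M maxM). Qed.

(** If [f] lies in every maximal left ideal then [1 - f] lies in none, so it
    has a left inverse; but [(1 - f) * f = 0]. *)
Lemma jacobson_idempotent f : f * f = f -> jacobson_radical f -> f = 0.
Proof.
move=> ff Jf; have [M maxM M1f|u u1f] := @left_inverse_ex (1 - f).
  have [_ M1 _] := iffLR (idealr_closedP M) maxM.1.
  by apply: M1; rewrite -(subrK f 1); exact: idealrD maxM.1 M1f (Jf M maxM).
by rewrite -[f]mul1r -u1f -mulrA mulrBl mul1r ff subrr mulr0.
Qed.

End LeftIdeals.

(** * Torsion in strongly J#-clean rings *)

Section Clean.
Variable S : nzRingType.
Hypothesis cleanS : strongly_jsharp_clean S.
Implicit Types g v : S.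

(** If [2 = e + j], then [e * 2 = e + e * j] gives [e * j = e], so that
    [2 = (1 + e) * j] is a left multiple of [j] by an element commuting
    with [j]. *)
Lemma clean_jsharp2 : jsharp (2%:R : S).
Proof.
have [e [j [def2 ee [m m_gt0 Jjm] ej]]] := cleanS 2%:R.
have ej_e : e * j = e.
  apply: (addrI e); rewrite -{1}ee -mulrDr -def2.
  by rewrite mulr_natr mulr2n.
have two : 2%:R = (1 + e) * j by rewrite mulrDl mul1r ej_e addrC.
exists m => //; rewrite two exprMn_comm; first exact: jacobson_mull.
by apply: commr_sym; apply: commrD; first exact: commr1.
Qed.

(** Write [g = e + j]. From [g * (1 - e) = (1 - e) * j] it follows that
    [g ^ m * (1 - e) = (1 - e) * j ^ m], which lies in the radical for some
    [m]; cancelling [g ^ m] on the left puts the idempotent [1 - e] in the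
    radical, so [e = 1] and [g - 1 = j]. *)
Lemma clean_jsharp_subr1 g v : v * g = 1 -> jsharp (g - 1).
Proof.
move=> vg1; have [e [j [def_g ee [m m_gt0 Jjm] ej]]] := cleanS g.
have vgX k : v ^+ k * g ^+ k = 1.
  elim: k => [|k IHk]; first by rewrite mulr1.
  by rewrite exprSr exprS mulrA -(mulrA _ v) vg1 mulr1.
have gf : g * (1 - e) = (1 - e) * j.
  by rewrite def_g mulrBr mulr1 mulrDl ee -ej (addrC e j) addrKA mulrBl mul1r.
have fX k : g ^+ k * (1 - e) = (1 - e) * j ^+ k.
  elim: k => [|k IHk]; first by rewrite mulr1 mul1r.
  by rewrite exprSr -mulrA gf mulrA IHk -mulrA -exprSr.
have Jf : jacobson_radical (1 - e).
  have <- : v ^+ m * (g ^+ m * (1 - e)) = 1 - e by rewrite mulrA vgX mul1r.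
  by rewrite fX; do 2!apply: jacobson_mull.
have ff : (1 - e) * (1 - e) = 1 - e.
  by rewrite mulrBl mul1r mulrBr mulr1 ee subrr subr0.
have /eqP := jacobson_idempotent ff Jf.
by rewrite subr_eq0 => /eqP e1; exists m => //; rewrite def_g -e1 addrC addKr.
Qed.

(** A maximal left ideal [M] containing [s = 1 + g + ... + g ^ (n - 1)]
    would contain a power of [n], because [n - s] is a multiple of [g - 1],
    and a power of [2]; these are coprime, so [1] would be in [M]. *)
Lemma clean_odd_torsion g n : odd n -> g ^+ n = 1 -> g = 1.
Proof.
move=> n_odd gn1; pose s := \sum_(i < n) g ^+ i.
have [k _ J2k] := clean_jsharp2.
have [m _ Jg1m] : jsharp (g - 1).
  apply: (@clean_jsharp_subr1 g (g ^+ n.-1)).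
  by rewrite -exprSr prednK // odd_gt0.
have comm_sumX l : GRing.comm (g - 1) (\sum_(i < l) g ^+ i).
  apply: commr_sum => i _; apply: commrX; apply: commr_sym.
  by apply: commrB; last exact: commr1.
pose t := - \sum_(i < n) \sum_(l < i) g ^+ l.
have comm_t : GRing.comm (g - 1) t by apply: commrN; apply: commr_sum.
have def_t : n%:R - s = (g - 1) * t.
  rewrite /t mulrN mulr_sumr.
  under eq_bigr do rewrite -subrX1.
  by rewrite sumrB sumr_const card_ord opprB.
have [M maxM Ms|u us1] := @left_inverse_ex S s.
  have idM := maxM.1; have [_ M1 _] := iffLR (idealr_closedP M) idM.
  (* Here [n - (n - s) = s] divides [n ^ m - (n - s) ^ m], and
     [(n - s) ^ m = t ^ m * (g - 1) ^ m] is in the radical. *)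
  have Mnm : M (n%:R ^+ m).
    have cns : GRing.comm n%:R (n%:R - s) by exact/commr_sym/commr_nat.
    rewrite -(subrK ((n%:R - s) ^+ m) (n%:R ^+ m)).
    apply: (idealrD idM); last first.
      rewrite def_t comm_t exprMn_comm; last exact: commr_sym.
      exact: (idealr_mull _ idM (Jg1m M maxM)).
    rewrite subrXX_comm // subKr.
    set c := \sum_(i < m) _.
    have -> : s * c = c * s.
      apply: commr_sum => i _; apply: commrM; apply: commrX.
        exact: commr_nat.
      by apply: commrB => //; exact: commr_nat.
    exact: (idealr_mull _ idM Ms).
  have : coprime (n ^ m) (2 ^ k).
    by rewrite coprimeXl // coprimeXr // coprime_sym coprime2n.
  have nm_gt0 : (0 < n ^ m)%N by rewrite expn_gt0 odd_gt0.
  have [a b def_ab _] := egcdnP (2 ^ k) nm_gt0.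
  rewrite /coprime => /eqP cop; rewrite cop in def_ab.
  apply: M1; have -> : 1 = a%:R * n%:R ^+ m + - b%:R * 2%:R ^+ k :> S.
    by rewrite mulNr -!natrX -!natrM def_ab natrD addrAC subrr add0r.
  by apply: (idealrD idM); apply: (idealr_mull _ idM) => //; exact: J2k.
apply/eqP; rewrite -subr_eq0; apply/eqP.
have <- : u * (s * (g - 1)) = g - 1 by rewrite mulrA us1 mul1r.
by rewrite -comm_sumX -subrX1 gn1 subrr mulr0.
Qed.

End Clean.

(** * Torsion in locally finite groups and the group ring *)

(** The powers of [x] lie in a finite subgroup, so they have a least period
    [n] > 0, and the [n] distinct powers of [x] form a subgroup. *)
Lemma odd_order_ex {G : groupType} (x : G) :
  locally_finite G ->
  (forall H : {fset G}, is_subgroup [set` H] -> odd #|` H|%fset) ->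
  exists2 n, odd n & (x ^+ n)%g = 1%g.
Proof.
move=> finG oddG.
pose A := generated_subgroup [set x].
have AX i : A (x ^+ i)%g.
  move=> B [[B1 BV] sxB].
  have Bx : x \in B by apply/mem_set/sxB.
  apply/set_mem; elim: i => [|i IHi]; first exact: B1.
  have Bxi : (x^-1)%g \in B by have := BV _ _ B1 Bx; rewrite mul1g.
  by have := BV _ _ IHi Bxi; rewrite invgK -expgSr.
have period i j : (i < j)%N -> (x ^+ i)%g = (x ^+ j)%g ->
    (0 < j - i)%N && ((x ^+ (j - i))%g == 1%g).
  by move=> ij xij; rewrite subn_gt0 ij expgnFr 1?ltnW // xij divgg eqxx.
have ex_period : exists n, (0 < n)%N && ((x ^+ n)%g == 1%g).
  apply: contrapT => noper.
  have injx : injective (fun i => x ^+ i)%g.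
    by move=> i j xij; case: (ltngtP i j) => // ltij; case: noper;
      [exists (j - i)%N|exists (i - j)%N]; exact: period.
  apply: infinite_nat; apply: sub_finite_set (finite_preimage _ _); last first.
  - exact: (finG [set x] (finite_set1 x)).
  - by move=> i j _ _; exact: injx.
  by move=> i _; exact: AX.
have [n /andP[n_gt0 /eqP xn1] min_n] := ex_minnP ex_period.
exists n => //.
have xmod i : (x ^+ (i %% n))%g = (x ^+ i)%g.
  by rewrite {2}(divn_eq i n) expgnDr mulnC expgnA xn1 expg1n mul1g.
pose H := [fset (x ^+ val i)%g | i in 'I_n]%fset.
have memH i : (x ^+ i)%g \in H.
  by apply/imfsetP; exists (Ordinal (ltn_pmod i n_gt0)) => //=; rewrite xmod.
have cardH : #|` H|%fset = n.
  rewrite card_imfset /=; first by rewrite -cardE card_ord.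
  have no_rep (i j : 'I_n) : (i < j)%N -> (x ^+ i)%g <> (x ^+ j)%g.
    move=> ltij /(period _ _ ltij)/min_n; apply/negP; rewrite -ltnNge.
    exact: leq_ltn_trans (leq_subr _ _) (ltn_ord j).
  move=> i j /= xij; apply: val_inj.
  by case: (ltngtP i j) => // [/no_rep|/no_rep/nesym]; case.
rewrite -cardH; apply: oddG; split; first by apply/mem_set; exact: (memH 0%N).
move=> _ _ /set_mem /imfsetP[i _ ->] /set_mem /imfsetP[j _ ->].
apply/mem_set => /=.
have -> : (x ^+ i / x ^+ j = x ^+ (i + (n - j)))%g.
  by rewrite expgnDr expgnFr ?xn1 ?mul1g // ltnW.
exact: memH.
Qed.

Theorem proposition3p5 (R : nzRingType) (G : groupType) :
  (exists g : G, g <> 1%g) ->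
  locally_finite G ->
  (forall H : {fset G}, is_subgroup [set` H]%classic -> odd #|` H|%fset) ->
  ~ strongly_jsharp_clean (group_ring R G).
Proof.
move=> [x x_neq1] finG oddG cleanRG.
have [n n_odd xn1] := odd_order_ex x finG oddG.
pose g : group_ring R G := << 1 *g x >>.
have gX i : g ^+ i = << 1 *g (x ^+ i)%g >> :> group_ring R G.
  elim: i => [//|i IHi]; rewrite exprS IHi.
  by rewrite [LHS]gr_mulUU mul1r expgS.
have := clean_odd_torsion cleanRG (g := g) n_odd.
rewrite gX xn1 => /(_ erefl) /(congr1 (fun h : {malg R[G]} => h@_x)).
have -> : 1 = << 1 *g 1%g >> :> group_ring R G by [].
rewrite mcoeffUU mcoeffU; case: eqP => [x1|_ /eqP]; first by case: x_neq1.
by rewrite oner_eq0.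
Qed.
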